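(* Let $r$ be a power of a prime, $k=\mathbb{F}_r(T)$, and let $\Pi$ denote the Carlitz factorial. Let $\{AC_n\}_{n\ge0}$ be a sequence in $k$ with $AC_0=1$, put $S(z)=\sum_{n=0}^\infty \frac{AC_n}{\Pi(n)}z^n\in k[[z]]$, and write $\frac{1}{S(z)}=\sum_{n=0}^\infty \lambda_n z^n$. For $\ell\in\mathbb{N}$ define $AC_n^{(\ell)}\in k$ by $(S(z))^\ell=\sum_{n=0}^\infty \frac{AC_n^{(\ell)}}{\Pi(n)}z^n$, and for $e\ge0$ put $D_\ell(e)=\sum_{i_1+\cdots+i_\ell=e,\ i_1,\dots,i_\ell\ge0}\lambda_{i_1}\cdots\lambda_{i_\ell}$. Then for every $m\ge1$, $$AC_m^{(\ell)}=(-1)^m\Pi(m)\det\begin{pmatrix} D_\ell(1)&1&&&\\ D_\ell(2)&D_\ell(1)&\ddots&&\\ \vdots&\vdots&\ddots&\ddots&\\ D_\ell(m-1)&D_\ell(m-2)&\cdots&D_\ell(1)&1\\ D_\ell(m)&D_\ell(m-1)&\cdots&D_\ell(2)&D_\ell(1) \end{pmatrix},$$ the $m\times m$ matrix whose $(i,j)$ entry is $D_\ell(i-j+1)$ for $i\ge j$, $1$ for $j=i+1$, and $0$ for $j>i+1$.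
   Context: For $i\ge1$ let $[i]=T^{r^i}-T$, and let $D_i=[i][i-1]^r\cdots[1]^{r^{i-1}}$ with $D_0=1$. For a nonnegative integer $n$ with base-$r$ expansion $n=\sum_{j=0}^m c_jr^j$ ($0\le c_j<r$), the Carlitz factorial is $\Pi(n)=\prod_{j=0}^m D_j^{c_j}$ (a nonzero element of $k$). *)

(* Defs.v *)
From HB Require Import structures.
From mathcomp Require Import all_boot all_order all_algebra.

Set Implicit Arguments.
Unset Strict Implicit.
Unset Printing Implicit Defensive.

Import GRing.Theory.
Local Open Scope ring_scope.

(* A formal power series over R is its coefficient sequence nat -> R. *)
Definition fps_one (R : comNzRingType) : nat -> R := fun n => (n == 0%N)%:R.

Definition fps_mul (R : comNzRingType) (a b : nat -> R) : nat -> R :=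
  fun n => \sum_(i < n.+1) a i * b (n - i)%N.

Definition fps_exp (R : comNzRingType) (a : nat -> R) (l : nat) : nat -> R :=
  iter l (fps_mul a) (fps_one R).

(* [i] = T^(r^i) - T, where r = #|F| and T = 'X. *)
Definition carlitz_bracket (F : finFieldType) (i : nat) : {poly F} :=
  'X^(#|F| ^ i) - 'X.

(* D_i = [i] [i-1]^r ... [1]^(r^(i-1)), with D_0 = 1 the empty product. *)
Definition carlitz_D (F : finFieldType) (i : nat) : {poly F} :=
  \prod_(j < i) carlitz_bracket F (i - j) ^+ (#|F| ^ j).

Definition base_digit (r n j : nat) : nat := ((n %/ r ^ j) %% r)%N.

(* Since #|F| >= 2, all base-#|F| digits of n of index j > n vanish, so the
   product ranges over the whole expansion. *)
Definition carlitz_factorial (F : finFieldType) (n : nat) :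
    {fraction {poly F}} :=
  tofrac (\prod_(j < n.+1) carlitz_D F j ^+ base_digit #|F| n j).

Definition carlitz_series (F : finFieldType) (c : nat -> {fraction {poly F}}) :
    nat -> {fraction {poly F}} :=
  fun n => c n / carlitz_factorial F n.

(* The sum over (i_1, ..., i_l) with i_1 + ... + i_l = e; each i_s is
   necessarily at most e, hence the index type 'I_e.+1. *)
Definition composition_sum (R : comNzRingType) (lam : nat -> R) (l e : nat) :
    R :=
  \sum_(t : {ffun 'I_l -> 'I_e.+1} | (\sum_(s < l) t s)%N == e)
    \prod_(s < l) lam (t s).

Definition toeplitz_hessenberg (R : comNzRingType) (d : nat -> R) (m : nat) :
    'M[R]_m :=
  \matrix_(i < m, j < m)
    if (j <= i)%N then d (i - j).+1 else if j == i.+1 :> nat then 1 else 0.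

(* Main.v *)
Require Import Defs.
From HB Require Import structures.
From mathcomp Require Import all_boot all_order all_algebra.

Set Implicit Arguments.
Unset Strict Implicit.
Unset Printing Implicit Defensive.

Import GRing.Theory.
Local Open Scope ring_scope.

(* The sequence [D_l(e)] lists the coefficients of [(1/S)^l = 1/S^l].  For any
   power series [d] with constant term 1 and inverse [x], the lower triangular
   Toeplitz matrices of [d] and [x] are inverse to each other, so [x_m], their
   bottom left entry, is by Cramer's rule a cofactor of the former.  Deleting
   the first row and the last column leaves the Hessenberg matrix. *)

Section TruncatedSeries.

Variable R : comNzRingType.
Implicit Types (a b : nat -> R) (l n N : nat).

(** Truncating to polynomials lets coefficient sequences inherit the ring laws of [{poly R}]. *)
Lemma fps_mul_coef N a b n : (n < N)%N ->
  fps_mul a b n = ((\poly_(i < N) a i) * (\poly_(i < N) b i))`_n.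
Proof.
move=> ltnN; rewrite coefM; apply: eq_bigr => -[i /= lein] _.
by rewrite !coef_poly (leq_trans lein ltnN) (leq_ltn_trans (leq_subr _ _) ltnN).
Qed.

Lemma fps_mulC a b : fps_mul a b =1 fps_mul b a.
Proof. by move=> n; rewrite !(@fps_mul_coef n.+1) // mulrC. Qed.

(** Congruence modulo ['X^N] is stable under multiplication. *)
Lemma coefM_trunc N (p p' q : {poly R}) :
    (forall i, (i < N)%N -> p`_i = p'`_i) ->
  forall n, (n < N)%N -> (q * p)`_n = (q * p')`_n.
Proof.
move=> eqp n ltnN; rewrite !coefM; apply: eq_bigr => -[i /= lein] _.
by rewrite eqp // (leq_ltn_trans (leq_subr _ _) ltnN).
Qed.

Lemma fps_exp_coef N a l n : (n < N)%N ->
  fps_exp a l n = ((\poly_(i < N) a i) ^+ l)`_n.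
Proof.
elim: l n => [|l IHl] n ltnN; first by rewrite expr0 coef1.
rewrite [LHS](fps_mul_coef _ _ ltnN) exprS; apply: coefM_trunc ltnN => i ltiN.
by rewrite coef_poly ltiN; apply: IHl.
Qed.

Lemma fps_exp_inv a b l : fps_mul a b =1 fps_one R ->
  fps_mul (fps_exp a l) (fps_exp b l) =1 fps_one R.
Proof.
(* The bound [N] is made independent of [n], so that the induction on [l] can vary the index while
   the truncations stay fixed. *)
move=> ab1 n; have [N ltnN] : exists N, (n < N)%N by exists n.+1.
have ab1c i : (i < N)%N ->
    ((\poly_(i < N) a i) * (\poly_(i < N) b i))`_i = (1 : {poly R})`_i.
  by move=> ltiN; rewrite -fps_mul_coef // ab1 coef1.
transitivity (((\poly_(i < N) a i) ^+ l * (\poly_(i < N) b i) ^+ l)`_n).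
  rewrite /fps_mul coefM; apply: eq_bigr => -[i /= lein] _.
  by rewrite !(@fps_exp_coef N) //; rewrite (leq_ltn_trans _ ltnN) ?leq_subr.
rewrite -exprMn /fps_one -coef1; elim: l n ltnN => [|l IHl] i ltiN //.
by rewrite exprSr (coefM_trunc _ ab1c) // mulr1 IHl.
Qed.

(** Expand the [l]-th power by distributivity: [t] picks one monomial per factor, their product has
    degree the sum of the [t s], and extracting the coefficient of degree [e] imposes the constraint
    on [t]. *)
Lemma composition_sumE a l : composition_sum a l =1 fps_exp a l.
Proof.
move=> e; rewrite (@fps_exp_coef e.+1) // poly_def -[l in RHS]card_ord.
rewrite -prodr_const bigA_distr_bigA /= coef_sum /composition_sum big_mkcond.
apply: eq_bigr => t _; rewrite scaler_prod prodrXr coefZ coefXn eq_sym.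
by case: eqP => _; rewrite ?mulr1 ?mulr0.
Qed.

Lemma det_toeplitz_hessenberg d x m : d 0%N = 1 -> fps_mul d x =1 fps_one R ->
  \det (toeplitz_hessenberg d m) = (-1) ^+ m * x m.
Proof.
move=> d0 dx1.
pose T y : 'M[R]_m.+1 := \matrix_(i, j) if (j <= i)%N then y (i - j)%N else 0.
have detT : \det (T d) = 1.
  rewrite det_trig; last first.
    by apply/is_trig_mxP => i j ltij; rewrite mxE leqNgt ltij.
  by rewrite big1 // => i _; rewrite mxE leqnn subnn.
pose c : 'cV[R]_m.+1 := \col_i x i.
(* This is [d x = 1] read up to degree [m]; the zeros of [T d] above the diagonal pad the
   convolution to a full row sum. *)
have Tc : T d *m c = delta_mx ord0 ord0.
  apply/matrixP => i j; rewrite !mxE ord1 eqxx andbT -[RHS]/(fps_one R i) -dx1.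
  rewrite fps_mulC /fps_mul.
  rewrite (big_ord_widen m.+1 (fun k => x k * d (i - k)%N)) //.
  rewrite [RHS]big_mkcond; apply: eq_bigr => k _.
  by rewrite !mxE ltnS; case: ifP => _; rewrite ?mul0r // mulrC.
have adjc : c = \adj (T d) *m delta_mx ord0 ord0.
  by rewrite -Tc mulmxA mul_adj_mx detT mul1mx.
have -> : x m = c ord_max ord0 by rewrite mxE.
(* The cofactor at row 0, column [m] carries the sign [(-1) ^+ m], which cancels the one in the
   statement. *)
rewrite adjc -colE !mxE /cofactor mulrA -exprD add0n addnn -mul2n exprM sqrrN.
rewrite !expr1n mul1r; congr (\det _); apply/matrixP => i j.
(* Dropping row 0 shifts the row index by one, so the old diagonal [d 0 = 1] becomes the
   superdiagonal of ones. *)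
rewrite !mxE lift0 lift_max; case: leqP => [leji|ltij].
  by rewrite leqW // subSn.
by case: eqP => [->|/eqP neq]; rewrite ?leqnn ?subnn // leqNgt ltn_neqAle eq_sym
  neq ltij.
Qed.

End TruncatedSeries.

(** As [#|F| ^ i] exceeds 1, the leading term cannot be cancelled by ['X]. *)
Lemma carlitz_bracket_neq0 (F : finFieldType) i :
  (0 < i)%N -> carlitz_bracket F i != 0.
Proof.
move=> i_gt0; have r_gt1 : (1 < #|F| ^ i)%N.
  by rewrite -(exp1n i) ltn_exp2r //; apply: card_finNzRing_gt1.
rewrite -size_poly_eq0 size_polyDl ?size_polyXn // size_polyN size_polyX.
by rewrite ltnS.
Qed.

Lemma carlitz_factorial_neq0 (F : finFieldType) n :
  carlitz_factorial F n != 0.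
Proof.
rewrite tofrac_eq0; apply/prodf_neq0 => j _; apply: expf_neq0.
apply/prodf_neq0 => i _; apply: expf_neq0.
by rewrite carlitz_bracket_neq0 // subn_gt0.
Qed.

Lemma carlitz_factorial0 (F : finFieldType) : carlitz_factorial F 0 = 1.
Proof.
by rewrite /carlitz_factorial big_ord1 /base_digit div0n mod0n expr0 tofrac1.
Qed.

Theorem theorem4 (F : finFieldType)
    (AC : nat -> {fraction {poly F}}) (hAC0 : AC 0%N = 1)
    (lam : nat -> {fraction {poly F}})
    (hlam : fps_mul (carlitz_series AC) lam =1 fps_one {fraction {poly F}})
    (l : nat) (ACl : nat -> {fraction {poly F}})
    (hACl : fps_exp (carlitz_series AC) l =1 carlitz_series ACl)
    (m : nat) (hm : (1 <= m)%N) :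
  ACl m = (-1) ^+ m * carlitz_factorial F m *
    \det (toeplitz_hessenberg (composition_sum lam l) m).
Proof.
have lam0 : lam 0%N = 1.
  move: (hlam 0%N); rewrite /fps_mul big_ord1 /carlitz_series hAC0.
  by rewrite carlitz_factorial0 divr1 mul1r.
have d0 : composition_sum lam l 0%N = 1.
  rewrite composition_sumE; elim: l {hACl} => [|k IHk] //.
  by rewrite /fps_exp /= /fps_mul big_ord1 lam0 mul1r; apply: IHk.
(* The determinant formula is applied with [d] the [l]-th power of [lam] and [x] that of the Carlitz
   series. *)
have dS : fps_mul (composition_sum lam l) (fps_exp (carlitz_series AC) l)
          =1 fps_one _.
  move=> n; rewrite -(fps_exp_inv l hlam) fps_mulC.
  by apply: eq_bigr => i _; rewrite composition_sumE.
rewrite (det_toeplitz_hessenberg m d0 dS) hACl /carlitz_series.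
rewrite mulrACA -expr2 sqrr_sign mul1r mulrC divfK //.
exact: carlitz_factorial_neq0.
Qed.
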